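(* Let $n=2^{b}+2^{a}$, where $b>a\ge 0$ are integers, and let $s$ be an odd positive integer. Assume that $s$ divides $\binom{n}{2^{a}}$. Furthermore, assume there is an integer $k$ with $1\le k\le n-1$ which is non-essential for $n$ in base $2$ (that is, $k\ne 2^{a},2^{b}$) and such that $s$ divides $\binom{n}{k}$. Then the cyclotomic polynomial $\Phi_{2s}$ is a factor of $Q_{n}(t)$.
   Context: For a permutation $\pi$ in the symmetric group $\mathfrak{S}_n$, its descent set is $\mathrm{Des}(\pi)=\{i\in[n-1] : \pi_i>\pi_{i+1}\}$, where $[n-1]=\{1,\dots,n-1\}$. For $S\subseteq[n-1]$ let $\beta_n(S)=|\{\pi\in\mathfrak{S}_n : \mathrm{Des}(\pi)=S\}|$. The $n$th descent set polynomial is $Q_n(t)=\sum_{S\subseteq[n-1]}t^{\beta_n(S)}$. $\Phi_m(t)$ denotes the $m$th cyclotomic polynomial; factors are in $\mathbb{Q}[t]$. For a prime $p$ and $1\le k\le n-1$, write $n=\sum_i n_ip^i$, $k=\sum_i k_ip^i$ with $0\le n_i,k_i<p$; $k$ is essential for $n$ in base $p$ if $k_i\le n_i$ for all $i$, and non-essential otherwise. *)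

(* Defs.v *)
From HB Require Import structures.
From mathcomp Require Import all_boot all_order all_algebra all_fingroup all_field.

Set Implicit Arguments.
Unset Strict Implicit.
Unset Printing Implicit Defensive.

Import GRing.Theory.

(* Positions and values are 0-based: i : 'I_n.-1 stands for the element i + 1  *)
(* of {1, ..., n - 1}.  Since i < n - 1, the cyclic successor ordS never wraps *)
(* around here.                                                                *)
Definition Des (n : nat) (w : {perm 'I_n}) : {set 'I_n.-1} :=
  [set i : 'I_n.-1 |
    let j : 'I_n := widen_ord (leq_pred n) i in (w (ordS j) < w j)%N].

Definition beta (n : nat) (S : {set 'I_n.-1}) : nat :=
  #|[set w : {perm 'I_n} | Des w == S]|.

Definition Q (n : nat) : {poly rat} :=
  (\sum_(S : {set 'I_n.-1}) 'X^(beta S))%R.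

Definition digit (p n i : nat) : nat := (n %/ p ^ i) %% p.

Definition essential (p n k : nat) : Prop :=
  forall i : nat, digit p k i <= digit p n i.

(* Main.v *)
(* Toggling an element k of a descent set S satisfies
     beta(S) + beta(S + k) = C(n, k) * beta_k(S') * beta_(n-k)(S''),
   where S', S'' are the parts of S before and after k.  If s divides C(n, k)
   and k is non-essential, then C(n, k) is even and the sum is 0 modulo 2s.  For
   k = 2^a the binomial coefficient is odd, and so are the other two factors,
   because all beta_(2^m) are odd; hence that sum is s modulo 2s.  Toggling both
   elements is therefore an involution on the sets S that changes beta by s
   modulo 2s, that is, negates z^beta(S) for z a primitive 2s-th root of 1. *)

Require Import Defs.
From HB Require Import structures.
From mathcomp Require Import all_boot all_order all_algebra all_fingroup all_field.
From mathcomp Require Import zify.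

Set Implicit Arguments.
Unset Strict Implicit.
Unset Printing Implicit Defensive.

Import GRing.Theory.

(** * Permutations with prescribed descents *)

(* D gives the required descents and K the positions at which they are
   required; positions are 1-based, the descent between the 0-based arguments
   i and j = i + 1 being at position j. *)
Definition descents_match (n : nat) (K D : pred nat) (w : {perm 'I_n}) : bool :=
  [forall i : 'I_n, forall j : 'I_n,
    ((j == i.+1 :> nat) && K j) ==> ((w j < w i) == D j)].

Definition nmatch (n : nat) (K D : pred nat) : nat :=
  #|[set w : {perm 'I_n} | descents_match K D w]|.

Lemma descents_matchP (n : nat) (K D : pred nat) (w : {perm 'I_n}) :
  reflect (forall i j : 'I_n, j = i.+1 :> nat -> K j -> (w j < w i) = D j)
          (descents_match K D w).
Proof.
apply: (iffP forallP) => [H i j ji Kj|H i].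
  by have /forallP/(_ j) := H i; rewrite ji eqxx -ji Kj => /eqP.
by apply/forallP => j; apply/implyP => /andP[/eqP ji Kj]; rewrite H.
Qed.

Lemma eq_nmatch (n : nat) (K D D' : pred nat) :
  (forall j, 0 < j < n -> D j = D' j) -> nmatch n K D = nmatch n K D'.
Proof.
move=> eqD; apply: eq_card => w; rewrite !inE.
by apply/descents_matchP/descents_matchP => H i j ji Kj;
  rewrite H // eqD // ltn_ord ji.
Qed.

(** Only the identity has no descent: an increasing [w] satisfies [i <= w i] by induction from the
    first position and [w i <= i] by induction from the last. *)
Lemma nmatch_pred0 (n : nat) : nmatch n predT pred0 = 1.
Proof.
have lt_mono (w : {perm 'I_n}) : descents_match predT pred0 w ->
    forall d (i j : 'I_n), j = i + d.+1 :> nat -> w i < w j.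
  move/descents_matchP => H; elim=> [|d IHd] i j ji.
    have /negbT := H i j (etrans ji (addn1 i)) isT.
    rewrite -leqNgt leq_eqVlt => /orP[/eqP/val_inj/perm_inj eij|//].
    by move: ji; rewrite eij => ?; lia.
  have lt_n : i + d.+1 < n by have := ltn_ord j; lia.
  have lt1 := IHd i (Ordinal lt_n) erefl.
  apply: ltn_trans lt1 _.
  have /negbT := H (Ordinal lt_n) j ltac:(by rewrite ji /=; lia) isT.
  rewrite -leqNgt leq_eqVlt => /orP[/eqP/val_inj/perm_inj eij|//].
  by move: ji; rewrite -eij /= => ?; lia.
rewrite /nmatch -(cards1 (1%g : {perm 'I_n})); apply: eq_card => w.
rewrite !inE; apply/idP/eqP => [/lt_mono mw|->]; last first.
  by apply/descents_matchP => i j ji _; rewrite !perm1 ji ltnNge leqnSn.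
have ge_id : forall m (i : 'I_n), i = m :> nat -> m <= w i.
  elim=> [//|m IHm] i im.
  have lt_n : m < n by have := ltn_ord i; lia.
  have := IHm (Ordinal lt_n) erefl; have := mw 0 (Ordinal lt_n) i.
  by rewrite addn1 im => /(_ erefl); lia.
(* Here [m] is the distance from [i] to the last position, so the induction runs downwards. *)
have le_id : forall m (i : 'I_n), i + m = n.-1 -> w i + m <= n.-1.
  elim=> [|m IHm] i im; first by have := ltn_ord (w i); lia.
  have lt_n : i.+1 < n by lia.
  have := IHm (Ordinal lt_n); have := mw 0 i (Ordinal lt_n).
  by rewrite /= addn1 => /(_ erefl) ?; lia.
apply/permP => i; rewrite perm1; apply/val_inj/eqP.
have := ltn_ord i; rewrite eqn_leq (ge_id i i) // andbT => lti.
by have := le_id (n.-1 - i) i ltac:(lia); rewrite /=; lia.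
Qed.

(** Without a requirement at [k], a permutation either agrees with [D] there or disagrees; the
    exclusive or flips [D] at [k] alone. *)
Lemma nmatch_free (n k : nat) (D : pred nat) : 0 < k < n ->
  nmatch n (predC1 k) D =
    nmatch n predT D + nmatch n predT (fun j => D j (+) (j == k)).
Proof.
case/andP=> k_gt0 lt_k_n.
have lt_k1 : k.-1 < n by lia.
pose i0 : 'I_n := Ordinal lt_k1; pose j0 : 'I_n := Ordinal lt_k_n.
have j0E : j0 = i0.+1 :> nat by rewrite /= prednK.
pose B := [set w : {perm 'I_n} | (w j0 < w i0) == D k].
rewrite /nmatch -(cardsID B); congr (_ + _); apply: eq_card => w; rewrite !inE.
  apply/andP/descents_matchP => [[/descents_matchP H /eqP Hk] i j ji _|H].
    have [jk|jk] := eqVneq (nat_of_ord j) k; last exact: H.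
    have -> : j = j0 by apply: val_inj.
    have -> : i = i0 by apply: val_inj => /=; lia.
    by rewrite Hk.
  by split; [apply/descents_matchP => i j ji _; apply: H | rewrite (H i0 j0)].
apply/andP/descents_matchP => [[Hk /descents_matchP H] i j ji _|H].
  have [jk|jk] := eqVneq (nat_of_ord j) k; last by rewrite addbF; apply: H.
  have -> : j = j0 by apply: val_inj.
  have -> : i = i0 by apply: val_inj => /=; lia.
  by rewrite addbT; move: Hk => /=; case: (D k); case: (_ < _).
split; first by rewrite (H i0 j0) //= eqxx addbT; case: (D k).
apply/descents_matchP => i j ji jk.
by rewrite (H i j) //; move: jk; rewrite /= => /negbTE ->; rewrite addbF.
Qed.

(** * Shuffling two permutations *)

Lemma enum_ord_ltn_sorted (n : nat) (A : {set 'I_n}) :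
  sorted ltn [seq val x | x <- enum A].
Proof.
have -> : enum A = [seq x <- enum 'I_n | x \in A].
  by rewrite [LHS]/enum_mem -enumT.
rewrite (subseq_sorted ltn_trans (map_subseq val (filter_subseq _ _))) //.
by rewrite val_enum_ord iota_ltn_sorted.
Qed.

(** Listing a set in increasing order preserves comparisons, so a shuffle keeps the descents inside
    each block. The defaults differ because [shuffle_fun] uses the position itself as default. *)
Lemma ltn_nth_enum (n : nat) (A : {set 'I_n}) (x y : 'I_n) (i j : nat) :
  i < #|A| -> j < #|A| -> (nth x (enum A) i < nth y (enum A) j) = (i < j).
Proof.
rewrite cardE => lti ltj; have lt_sort := enum_ord_ltn_sorted A.
have mono a b : a < size (enum A) -> b < size (enum A) -> a < b ->
    nth x (enum A) a < nth x (enum A) b.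
  move=> lta ltb ab; have := sorted_ltn_nth ltn_trans 0 lt_sort.
  move=> /(_ a b); rewrite !inE size_map lta ltb => /(_ isT isT ab).
  by rewrite !(nth_map x).
rewrite (set_nth_default x y) //.
case: (ltngtP i j) => [ij|ji|->]; last by rewrite ltnn.
  exact: mono.
by apply/negbTE; rewrite -leqNgt ltnW // mono.
Qed.

Section Shuffle.

Variables k m : nat.

Definition shuffle_data : finType :=
  ({A : {set 'I_(k + m)} | #|A| == k} * {perm 'I_k} * {perm 'I_m})%type.

(* Send the first k positions to A, in the relative order u, and the others to
   the complement of A, in the relative order v. *)
Definition shuffle_fun (X : shuffle_data) (x : 'I_(k + m)) : 'I_(k + m) :=
  let: (A, u, v) := X in
  match split x with
  | inl i => nth x (enum (val A)) (u i)
  | inr j => nth x (enum (~: val A)) (v j)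
  end.

Lemma card_shuffle_setC (A : {A : {set 'I_(k + m)} | #|A| == k}) :
  #|~: val A| = m.
Proof. by rewrite cardsCs setCK card_ord (eqP (valP A)) addKn. Qed.

Lemma shuffle_funL X i :
  shuffle_fun X (lshift m i) =
    nth (lshift m i) (enum (val X.1.1)) (X.1.2 i).
Proof. by case: X => -[A u] v; rewrite /shuffle_fun (unsplitK (inl i)). Qed.

Lemma shuffle_funR X j :
  shuffle_fun X (rshift k j) =
    nth (rshift k j) (enum (~: val X.1.1)) (X.2 j).
Proof. by case: X => -[A u] v; rewrite /shuffle_fun (unsplitK (inr j)). Qed.

Lemma shuffle_bndL (X : shuffle_data) i : X.1.2 i < #|val X.1.1|.
Proof. by rewrite (eqP (valP X.1.1)). Qed.

Lemma shuffle_bndR (X : shuffle_data) j : X.2 j < #|~: val X.1.1|.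
Proof. by rewrite card_shuffle_setC. Qed.

(** This separates the two blocks and lets [A] be recovered from the permutation. *)
Lemma mem_shuffle_fun X x : (shuffle_fun X x \in val X.1.1) = (x < k).
Proof.
rewrite -(splitK x); case: (split x) => [i|j] /=.
  by rewrite shuffle_funL -mem_enum mem_nth -?cardE ?shuffle_bndL ?ltn_ord.
rewrite shuffle_funR ltnNge leq_addr; apply/negbTE.
by rewrite -in_setC -mem_enum mem_nth // -cardE shuffle_bndR.
Qed.

Lemma shuffle_fun_inj X : injective (shuffle_fun X).
Proof.
move=> x y exy; have := mem_shuffle_fun X x; rewrite exy mem_shuffle_fun.
move: exy; rewrite -(splitK x) -(splitK y).
case: (split x) (split y) => [i|i] [j|j] /=.
- rewrite !shuffle_funL (set_nth_default (lshift m j)) -?cardE ?shuffle_bndL //.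
  move/eqP; rewrite nth_uniq ?enum_uniq -?cardE ?shuffle_bndL //.
  by move/eqP/val_inj/perm_inj->.
(* In the mixed cases the positions lie on different sides of [k], against the equality of
   memberships. *)
- by have := ltn_ord i; lia.
- by have := ltn_ord j; lia.
- rewrite !shuffle_funR (set_nth_default (rshift k j)) -?cardE ?shuffle_bndR //.
  move/eqP; rewrite nth_uniq ?enum_uniq -?cardE ?shuffle_bndR //.
  by move/eqP/val_inj/perm_inj->.
Qed.

Definition shuffle (X : shuffle_data) : {perm 'I_(k + m)} :=
  perm (@shuffle_fun_inj X).

Lemma shuffle_inj : injective shuffle.
Proof.
move=> X Y eXY.
have eqf x : shuffle_fun X x = shuffle_fun Y x.
  by have := congr1 (fun w : {perm _} => w x) eXY; rewrite !permE.
have eqA : X.1.1 = Y.1.1.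
  apply/val_inj/setP => y.
  have [x <-] : exists x, shuffle X x = y.
    by exists ((shuffle X)^-1%g y); rewrite permKV.
  by rewrite {2}eXY !permE !mem_shuffle_fun.
have eqL i : X.1.2 i = Y.1.2 i.
  have := eqf (lshift m i); rewrite !shuffle_funL -eqA => /eqP.
  rewrite nth_uniq ?enum_uniq -?cardE ?shuffle_bndL ?eqA ?shuffle_bndL //.
  by move/eqP/val_inj.
have eqR i : X.2 i = Y.2 i.
  have := eqf (rshift k i); rewrite !shuffle_funR -eqA => /eqP.
  rewrite nth_uniq ?enum_uniq -?cardE ?shuffle_bndR ?eqA ?shuffle_bndR //.
  by move/eqP/val_inj.
case: X Y eqA eqL eqR {eXY eqf} => [[A u] v] [[A' u'] v'] /= -> /permP -> eqR.
by congr (_, _); apply/permP.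
Qed.

(** This count turns injectivity of [shuffle] into bijectivity. *)
Lemma card_shuffle_data : #|shuffle_data| = (k + m)`!.
Proof.
rewrite !card_prod card_sig !card_Sn -(bin_fact (leq_addr m k)) addKn -mulnA.
congr (_ * _); rewrite -[in RHS](card_ord (k + m)) -card_draws.
by apply: eq_card => A; rewrite !inE.
Qed.

Lemma shuffle_bij : bijective shuffle.
Proof.
by apply: inj_card_bij shuffle_inj _; rewrite card_shuffle_data card_Sn.
Qed.

Lemma ltn_shuffleL X i j :
  (shuffle X (lshift m i) < shuffle X (lshift m j)) = (X.1.2 i < X.1.2 j).
Proof. by rewrite !permE !shuffle_funL ltn_nth_enum ?shuffle_bndL. Qed.

Lemma ltn_shuffleR X i j :
  (shuffle X (rshift k i) < shuffle X (rshift k j)) = (X.2 i < X.2 j).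
Proof. by rewrite !permE !shuffle_funR ltn_nth_enum ?shuffle_bndR. Qed.

(** With position [k] free, no condition links the two blocks: [A] is arbitrary, which gives the
    binomial, while [u] and [v] are constrained independently. *)
Lemma nmatch_split (K D : pred nat) : ~~ K k ->
  nmatch (k + m) K D =
    'C(k + m, k) * (nmatch k K D
                    * nmatch m (fun j => K (k + j)) (fun j => D (k + j))).
Proof.
move=> Kk; rewrite /nmatch -(on_card_preimset (f := shuffle)); last first.
  exact/onW_bij/shuffle_bij.
have -> : 'C(k + m, k) = #|[set: {A : {set 'I_(k + m)} | #|A| == k}]|.
  rewrite cardsT card_sig -[in LHS](card_ord (k + m)) -card_draws.
  by apply: eq_card => A; rewrite !inE.
rewrite mulnA -!cardsX; apply: eq_card => -[[A u] v]; rewrite !inE /=.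
apply/descents_matchP/andP => [H|[/descents_matchP Hu /descents_matchP Hv] i j].
  split; apply/descents_matchP => i j ji Kj.
    by rewrite -(ltn_shuffleL (A, u, v)) (H _ (lshift m j)).
  rewrite -(ltn_shuffleR (A, u, v)) (H _ (rshift k j)) //=.
  by rewrite ji addnS.
rewrite -(splitK i) -(splitK j).
case: (split i) (split j) => [i'|i'] [j'|j'] /= ji Kj.
- by rewrite ltn_shuffleL Hu.
(* The only consecutive arguments in different blocks are [k - 1] and [k], whose position [k] is
   free. *)
- have j0 : k + j' = k by have := ltn_ord i'; lia.
  by move: Kj; rewrite j0 (negbTE Kk).
- by have := ltn_ord j'; lia.
- by rewrite ltn_shuffleR Hv //; lia.
Qed.

End Shuffle.

(** * Binomial coefficients modulo 2 *)

Lemma coef_Xadd1_exp (R : comNzRingType) (n k : nat) :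
  ((('X + 1) ^+ n)`_k = 'C(n, k)%:R :> R)%R.
Proof.
have -> : (('X + 1) ^+ n = \poly_(i < n.+1) 'C(n, i)%:R :> {poly R})%R.
  rewrite poly_def addrC exprDn; apply: eq_bigr => i _.
  by rewrite expr1n mul1r scaler_nat.
by rewrite coef_poly ltnS; case: leqP => // ltnk; rewrite bin_small.
Qed.

Lemma natr_F2_eq0 (n : nat) : (n%:R == 0 :> 'F_2)%R = ~~ odd n.
Proof. by rewrite -(dvdn_pcharf (pchar_Fp (isT : prime 2))) dvdn2. Qed.

Lemma exp_pow2_Xadd1 (m : nat) :
  (('X + 1) ^+ (2 ^ m) = 'X^(2 ^ m) + 1 :> {poly 'F_2})%R.
Proof.
rewrite exprDn_pchar ?expr1n // (eq_pnat _ (pchar_poly _)) pnatX.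
by rewrite pnatE // pchar_Fp.
Qed.

Lemma even_bin_pow2 (m k : nat) : 0 < k < 2 ^ m -> ~~ odd 'C(2 ^ m, k).
Proof.
case/andP=> k_gt0 ltk; rewrite -natr_F2_eq0 -coef_Xadd1_exp exp_pow2_Xadd1.
by rewrite coefD coefXn coef1 (ltn_eqF ltk) (gtn_eqF k_gt0).
Qed.

(** Over ['F_2] the power [('X + 1) ^+ n] is [('X^(2 ^ b) + 1) * ('X^(2 ^ a) + 1)], whose only
    intermediate monomials have the distinct degrees [2 ^ a] and [2 ^ b]. *)
Lemma odd_bin_pow2D (a b k : nat) : a < b -> 0 < k < 2 ^ b + 2 ^ a ->
  odd 'C(2 ^ b + 2 ^ a, k) = (k == 2 ^ a) || (k == 2 ^ b).
Proof.
move=> ab /andP[k_gt0 ltk]; rewrite -[LHS]negbK -natr_F2_eq0 -coef_Xadd1_exp.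
rewrite exprD !exp_pow2_Xadd1 mulrDl !mulrDr -exprD !mulr1 mul1r !coefD.
rewrite !coefXn coef1 (ltn_eqF ltk) (gtn_eqF k_gt0) add0r addr0.
have ne_ba : (2 ^ b == 2 ^ a) = false by rewrite eqn_exp2l // gtn_eqF.
by case: (eqVneq k (2 ^ b)) => [->|_]; rewrite ?ne_ba //=; case: (k == _).
Qed.

(** The binary digits of the sum are 1 exactly at [a] and [b]. By contraposition, a non-essential
    [k] has an even binomial coefficient. *)
Lemma essential_pow2D (a b k : nat) : a < b -> (k == 2 ^ a) || (k == 2 ^ b) ->
  essential 2 (2 ^ b + 2 ^ a) k.
Proof.
move=> ab; have digit_pow2 c i : digit 2 (2 ^ c) i = (c == i).
  rewrite /digit; case: (ltngtP c i) => [ci|ic|->].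
  - by rewrite divn_small // ltn_exp2l.
  - by rewrite -expnB ?(ltnW ic) // -(subnSK ic) expnS mulnC modnMl.
  - by rewrite divnn expn_gt0.
have digit_sum i : digit 2 (2 ^ b + 2 ^ a) i = (a == i) + (b == i).
  rewrite -!digit_pow2 /digit.
  case: (leqP i b) => bi.
    rewrite divnDl ?dvdn_exp2l // -modnDm.
    rewrite -!/(digit 2 _ i) !digit_pow2.
    by case: (eqVneq a i) => [<-|_]; rewrite ?(gtn_eqF ab) //=; case: (b == _).
  (* For [i > b], all quotients vanish since [2 ^ b + 2 ^ a < 2 ^ b.+1 <= 2 ^ i]. *)
  rewrite !divn_small ?ltn_exp2l ?(ltn_trans ab) //.
  rewrite (leq_trans (n := 2 ^ b + 2 ^ b)) ?ltn_add2l ?ltn_exp2l //.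
  by rewrite addnn -mul2n -expnS leq_exp2l.
by case/orP=> /eqP -> i; rewrite digit_sum digit_pow2 ?leq_addr ?leq_addl.
Qed.

(** * Toggling one descent *)

Lemma nmatch_toggle (n k : nat) (D : pred nat) : 0 < k < n ->
  nmatch n predT D + nmatch n predT (fun j => D j (+) (j == k)) =
    'C(n, k) * (nmatch k predT D * nmatch (n - k) predT (fun j => D (k + j))).
Proof.
move=> kn; rewrite -nmatch_free //; have le_kn : k <= n by lia.
rewrite -{1 2}(subnKC le_kn) nmatch_split /= ?eqxx // subnKC //.
(* Inside either block every position differs from [k], so the weakened requirement is again the
   full one. *)
congr (_ * (_ * _)).
  apply: eq_card => w; rewrite !inE.
  apply/descents_matchP/descents_matchP => H i j ji _; apply: H => //=.
  by rewrite ltn_eqF.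
apply: eq_card => w; rewrite !inE.
apply/descents_matchP/descents_matchP => H i j ji _; apply: H => //=.
by rewrite ji; lia.
Qed.

(** Starting from the empty descent set, with count 1, descents are added one at a time. Each step
    preserves parity, since the two counts add up to a multiple of an even ['C(2 ^ m, l.+1)]. *)
Lemma odd_nmatch_pow2 (m : nat) (D : pred nat) : odd (nmatch (2 ^ m) predT D).
Proof.
suff odd_prefix l : odd (nmatch (2 ^ m) predT (fun j => (j <= l) && D j)).
  rewrite (eq_nmatch _ (D' := fun j => (j <= 2 ^ m) && D j)) //.
  by move=> j /andP[_ /ltnW ->].
elim: l => [|l IHl].
  by rewrite (eq_nmatch _ (D' := pred0)) ?nmatch_pred0 // => -[].
have [Dl|nDl] := boolP (D l.+1); last first.
  rewrite (eq_nmatch _ (D' := fun j => (j <= l) && D j)) // => j _.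
  rewrite leq_eqVlt ltnS; case: (eqVneq j l.+1) => [->|//].
  by rewrite (negbTE nDl) !andbF.
have [ltl|gel] := ltnP l.+1 (2 ^ m); last first.
  rewrite (eq_nmatch _ (D' := fun j => (j <= l) && D j)) // => j /andP[_ ltj].
  by have -> : (j <= l.+1) = (j <= l) by lia.
have := @nmatch_toggle (2 ^ m) l.+1 (fun j => (j <= l) && D j) ltl.
move/(congr1 odd); rewrite oddD IHl oddM (negbTE (even_bin_pow2 _)) //=.
move/negbFE; rewrite (eq_nmatch _ (D' := fun j => (j <= l.+1) && D j)) // => j _.
rewrite [j <= l.+1]leq_eqVlt ltnS.
by case: (eqVneq j l.+1) => [->|_]; rewrite ?Dl ?ltnn ?addbF.
Qed.

(** * From descent sets to predicates on positions *)

(** The shift passes from the 0-based elements of [S] to the 1-based positions of [nmatch]. *)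
Definition descent_pred (n : nat) (S : {set 'I_n.-1}) : pred nat :=
  fun j => [exists i in S, i.+1 == j].

Lemma descent_predE (n : nat) (S : {set 'I_n.-1}) (i : 'I_n.-1) :
  descent_pred S i.+1 = (i \in S).
Proof.
apply/existsP/idP => [[x /andP[xS]]|iS]; last by exists i; rewrite iS eqxx.
by rewrite eqSS => /eqP/val_inj <-.
Qed.

Lemma beta_nmatch (n : nat) (S : {set 'I_n.-1}) :
  beta S = nmatch n predT (descent_pred S).
Proof.
apply: eq_card => w; rewrite !inE.
have ordSE (i : 'I_n.-1) : ordS (widen_ord (leq_pred n) i) = i.+1 :> nat.
  by rewrite /= modn_small //; have := ltn_ord i; lia.
apply/eqP/descents_matchP => [<- i j ji _|H].
  have lti : i < n.-1 by have := ltn_ord j; lia.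
  rewrite ji (descent_predE _ (Ordinal lti)) inE.
  have -> : widen_ord (leq_pred n) (Ordinal lti) = i by apply: val_inj.
  congr (w _ < _); apply: val_inj; rewrite /= modn_small //; lia.
apply/setP => i; rewrite inE /= -descent_predE -(ordSE i).
by rewrite (H (widen_ord (leq_pred n) i) _ (ordSE i)).
Qed.

Definition toggle (n : nat) (i : 'I_n) (S : {set 'I_n}) : {set 'I_n} :=
  [set x | (x \in S) (+) (x == i)].

Lemma toggleK (n : nat) (i : 'I_n) : involutive (toggle i).
Proof. by move=> S; apply/setP=> x; rewrite !inE -addbA addbb addbF. Qed.

Lemma beta_toggle (n : nat) (i : 'I_n.-1) (S : {set 'I_n.-1}) :
  beta S + beta (toggle i S) = 'C(n, i.+1) *
    (nmatch i.+1 predT (descent_pred S)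
     * nmatch (n - i.+1) predT (fun j => descent_pred S (i.+1 + j))).
Proof.
have lti : 0 < i.+1 < n by have := ltn_ord i; lia.
rewrite -nmatch_toggle // !beta_nmatch; congr (_ + _).
apply: eq_nmatch => -[//|j] /= ltj; have lt1 : j < n.-1 by lia.
by rewrite !(descent_predE _ (Ordinal lt1)) inE.
Qed.

(** * Cyclotomic factors and the final cancellation *)

(** The cyclotomic polynomial is the minimal polynomial of [z] over the rationals, so divisibility
    means vanishing at [z]. *)
Lemma Cyclotomic_dvd_rat (n : nat) (z : algC) (q : {poly rat}) :
  (n.-primitive_root z)%R ->
  (map_poly (intr : int -> rat) 'Phi_n %| q)%R = root (map_poly ratr q) z.
Proof.
move=> prim_z; have [p [pE _ ->]] := minCpolyP z; congr (_ %| _)%R.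
apply: (map_poly_inj (ratr : rat -> algC)).
rewrite -pE (minCpoly_cyclotomic prim_z) -(Cintr_Cyclotomic prim_z) -map_poly_comp.
by apply: eq_map_poly => x; rewrite /= ratr_int.
Qed.

Theorem theorem5p1 (n a b s : nat)
    (hab : a < b) (hn : n = 2 ^ b + 2 ^ a)
    (s_gt0 : 0 < s) (s_odd : odd s)
    (hs : s %| 'C(n, 2 ^ a))
    (hk : exists k : nat,
        [/\ 1 <= k <= n.-1, ~ essential 2 n k & s %| 'C(n, k)]) :
  (map_poly (intr : int -> rat) 'Phi_(2 * s) %| Q n)%R.
Proof.
case: hk => k [/andP[k_gt0 le_k] ness_k s_k].
have n_gt : 2 ^ a < n by rewrite hn -[X in X < _]add0n ltn_add2r expn_gt0.
have nB : n - 2 ^ a = 2 ^ b by rewrite hn addnK.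
have pow_gt0 : 0 < 2 ^ a by rewrite expn_gt0.
have lt_i : k.-1 < n.-1 by lia.
have lt_j : (2 ^ a).-1 < n.-1 by lia.
pose i := Ordinal lt_i; pose j := Ordinal lt_j.
have [z prim_z] := C_prim_root_exists (isT : 0 < 2 * s.-1.+1).
rewrite prednK // in prim_z.
(* The square of [z ^+ s] is 1, but [z ^+ s] is not, because [2 * s] cannot divide [s]. *)
have zs : (z ^+ s = -1)%R.
  have /eqP : ((z ^+ s) ^+ 2 = 1)%R by rewrite -exprM mulnC prim_expr_order.
  rewrite sqrf_eq1 => /orP[|/eqP //]; rewrite -(prim_order_dvd prim_z).
  by move/(dvdn_leq s_gt0); lia.
have toggle_i S : (z ^+ beta (toggle i S) * z ^+ beta S = 1)%R.
  rewrite -exprD addnC beta_toggle /= prednK // exprM.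
  suff /eqP-> : (z ^+ 'C(n, k) == 1)%R by rewrite expr1n.
  rewrite -(prim_order_dvd prim_z).
  rewrite Gauss_dvd ?coprime2n // s_k dvdn2 andbT hn odd_bin_pow2D //; last lia.
  by apply/negP => /(essential_pow2D hab); rewrite -hn.
(* The exponent is an odd multiple of [s]: the binomial is odd, and the blocks have sizes [2 ^ a]
   and [2 ^ b], so both of their counts are odd. *)
have toggle_j S : (z ^+ beta (toggle j S) * z ^+ beta S = -1)%R.
  rewrite -exprD addnC beta_toggle /= prednK // nB.
  case/dvdnP: hs => q qE.
  have odd_q : odd q.
    have : odd 'C(n, 2 ^ a) by rewrite hn odd_bin_pow2D ?eqxx -?hn ?pow_gt0.
    by rewrite qE oddM => /andP[].
  rewrite qE -mulnA mulnCA exprM zs -signr_odd !oddM odd_q.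
  by rewrite !odd_nmatch_pow2.
rewrite (Cyclotomic_dvd_rat _ prim_z) /root /Q rmorph_sum horner_sum /=.
set sum := (\sum_S _)%R.
suff : (sum = - sum)%R by move/eqP; rewrite -addr_eq0 -mulr2n Num.Theory.mulrn_eq0.
(* Replacing [S] by [toggle i (toggle j S)] on the left reduces the claim to single terms: the
   double toggle negates each one. Multiplying by [z ^+ beta (toggle j S)] turns both sides into the
   products computed above. *)
rewrite {1}/sum (reindex_inj (inv_inj (toggleK i))).
rewrite (reindex_inj (inv_inj (toggleK j))) -sumrN; apply: eq_bigr => S _.
rewrite !map_polyXn !hornerXn.
have z_unit : (z ^+ beta (toggle j S) != 0)%R.
  by rewrite expf_neq0 // (prim_root_eq0 prim_z); lia.
by apply: (mulIf z_unit); rewrite toggle_i mulNr mulrC toggle_j opprK.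
Qed.
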